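(* For a dimension $d\ge 1$, let $\mathcal{G}_{\mathsf{half}}$ denote the set of all halfspace-symmetric probability distributions on $\mathbb{R}^d$. Then the breakdown points of the Tukey median over $\mathcal{G}_{\mathsf{half}}$, under additive corruptions and under total variation corruptions respectively, are $$\epsilon^*_{\mathsf{add}}(\mathcal{G}_{\mathsf{half}}) = \begin{cases} 1/2, & d = 1 \\ 1/3, & d\geq 2 \end{cases}, \qquad \epsilon^*_{\mathsf{TV}}(\mathcal{G}_{\mathsf{half}}) = \begin{cases} 1/2, & d = 1 \\ 1/3, & d = 2 \\ 1/4, & d \geq 3. \end{cases}$$
   Context: All distributions are probability distributions on $\mathbb{R}^d$, and $\|\cdot\|$ is a norm on $\mathbb{R}^d$. Tukey depth and median: for a distribution $p$ and $\mu\in\mathbb{R}^d$, $D_{\mathsf{Tukey}}(\mu,p)=\inf_{v\in\mathbb{R}^d} p(v^\top (X-\mu)\ge 0)$. The Tukey median is the set $T(p)=\operatorname{argmax}_{\mu\in\mathbb{R}^d} D_{\mathsf{Tukey}}(\mu,p)$ of all maximizers. Halfspace-symmetric: $p$ is halfspace-symmetric if there is a point $\mu\in\mathbb{R}^d$ (called the center) such that, for $X\sim p$ and every $v\in\mathbb{R}^d$, $v^\top(X-\mu)$ and $-v^\top(X-\mu)$ are equal in distribution. Corruptions: for $\epsilon\in[0,1)$, $\mathcal{C}_{\mathsf{add}}(p^*,\epsilon)=\{(1-\epsilon)p^*+\epsilon r : r \text{ a probability distribution on } \mathbb{R}^d\}$. The total variation distance is $\mathsf{TV}(p,q)=\sup_A\,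 (p(A)-q(A))$, the supremum being over events $A$. Maximum bias of the Tukey median: $$b_{\mathsf{add}}(p^*,\epsilon)=\sup_{p\in\mathcal{C}_{\mathsf{add}}(p^*,\epsilon),\,x\in T(p),\,y\in T(p^* )}\|x-y\|,\qquad b_{\mathsf{TV}}(p^*,\epsilon)=\sup_{p:\ \mathsf{TV}(p^*,p)\le\epsilon,\ x\in T(p),\ y\in T(p^* )}\|x-y\|.$$ Breakdown points: $\epsilon^*_{\mathsf{add}}(p^* )=\inf\{\epsilon : b_{\mathsf{add}}(p^*,\epsilon)=\infty\}$ and $\epsilon^*_{\mathsf{TV}}(p^* )=\inf\{\epsilon : b_{\mathsf{TV}}(p^*,\epsilon)=\infty\}$. For a family $\mathcal{G}$ of distributions, $\epsilon^*_{\mathsf{add}}(\mathcal{G})=\inf_{q\in\mathcal{G}}\epsilon^*_{\mathsf{add}}(q)$ and $\epsilon^*_{\mathsf{TV}}(\mathcal{G})=\inf_{q\in\mathcal{G}}\epsilon^*_{\mathsf{TV}}(q)$. *)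

(* Defs.v *)
From HB Require Import structures.
From mathcomp Require Import all_boot all_order all_algebra.
From mathcomp Require Import all_classical all_reals all_analysis.

Set Implicit Arguments.
Unset Strict Implicit.
Unset Printing Implicit Defensive.

Import Order.TTheory GRing.Theory Num.Theory.
Import numFieldNormedType.Exports.

Local Open Scope classical_set_scope.
Local Open Scope ring_scope.

(* R^d as column vectors, with its Borel sigma-algebra. *)
Notation borelRd R d := (g_sigma_algebraType (@open 'cV[R%type]_d)).

Notation distr R d := (probability (borelRd R d) R%type).

Definition dot (R : realType) (d : nat) (v x : 'cV[R]_d) : R :=
  (v^T *m x) ord0 ord0.

Record is_norm (R : realType) (d : nat) (N : 'cV[R]_d -> R) : Prop := IsNorm {
  norm_triangle : forall x y, N (x + y) <= N x + N y ;
  norm_homogeneous : forall (a : R) x, N (a *: x) = `|a| * N x ;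
  norm_definite : forall x, N x = 0 -> x = 0 }.

Definition tukey_depth (R : realType) (d : nat) (mu : 'cV[R]_d)
    (p : distr R d) : \bar R :=
  ereal_inf [set p [set x : 'cV[R]_d | 0 <= dot v (x - mu)] | v in setT].

Definition tukey_median (R : realType) (d : nat) (p : distr R d) :
    set 'cV[R]_d :=
  [set mu | forall nu, (tukey_depth nu p <= tukey_depth mu p)%E].

Definition halfspace_symmetric (R : realType) (d : nat) : set (distr R d) :=
  [set p : distr R d | exists mu : 'cV[R]_d, forall (v : 'cV[R]_d) (B : set R),
    measurable B ->
    pushforward p (fun x : borelRd R d => dot v (x - mu)) B =
    pushforward p (fun x : borelRd R d => - dot v (x - mu)) B].

(* Two probabilities are identified when they agree on Borel sets: their values
   on other sets carry no information. *)
Definition corrupt_add (R : realType) (d : nat) (ps : distr R d) (eps : R) :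
    set (distr R d) :=
  [set p : distr R d | exists r : distr R d, forall A, measurable A ->
    p A = ((1 - eps)%:E * ps A + eps%:E * r A)%E].

Definition TV (R : realType) (d : nat) (p q : distr R d) : \bar R :=
  ereal_sup [set (p A - q A)%E | A in measurable].

Definition corrupt_TV (R : realType) (d : nat) (ps : distr R d) (eps : R) :
    set (distr R d) :=
  [set p : distr R d | (TV ps p <= eps%:E)%E].

Definition max_bias (R : realType) (d : nat) (N : 'cV[R]_d -> R)
    (C : set (distr R d)) (ps : distr R d) : \bar R :=
  ereal_sup [set b | exists p x y,
    [/\ C p, tukey_median p x, tukey_median ps y & b = (N (x - y))%:E]].

Definition bias_add (R : realType) (d : nat) (N : 'cV[R]_d -> R)
    (ps : distr R d) (eps : R) : \bar R :=
  max_bias N (corrupt_add ps eps) ps.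

Definition bias_TV (R : realType) (d : nat) (N : 'cV[R]_d -> R)
    (ps : distr R d) (eps : R) : \bar R :=
  max_bias N (corrupt_TV ps eps) ps.

(* Additive corruption is only defined for levels in [0, 1[.  Infima are taken
   in the extended reals, so that of the empty set is +oo. *)
Definition breakdown_add (R : realType) (d : nat) (N : 'cV[R]_d -> R)
    (ps : distr R d) : \bar R :=
  ereal_inf [set eps%:E | eps in
    [set eps : R | 0 <= eps < 1 /\ bias_add N ps eps = +oo%E]].

Definition breakdown_TV (R : realType) (d : nat) (N : 'cV[R]_d -> R)
    (ps : distr R d) : \bar R :=
  ereal_inf [set eps%:E | eps in [set eps : R | bias_TV N ps eps = +oo%E]].

Definition family_breakdown_add (R : realType) (d : nat) (N : 'cV[R]_d -> R)
    (G : set (distr R d)) : \bar R :=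
  ereal_inf [set breakdown_add N q | q in G].

Definition family_breakdown_TV (R : realType) (d : nat) (N : 'cV[R]_d -> R)
    (G : set (distr R d)) : \bar R :=
  ereal_inf [set breakdown_TV N q | q in G].

(* Main.v *)
Require Import Defs.
From HB Require Import structures.
From mathcomp Require Import all_boot all_order all_algebra.
From mathcomp Require Import all_classical all_reals all_analysis.
From mathcomp Require Import ring lra.

Set Implicit Arguments.
Unset Strict Implicit.
Unset Printing Implicit Defensive.

Import Order.TTheory GRing.Theory Num.Theory.
Import numFieldNormedType.Exports.

Local Open Scope classical_set_scope.
Local Open Scope ring_scope.

(** A point far from the bulk of the original distribution [q] is cut off by a
    halfspace that [q] hardly charges, so that its depth under the corrupted
    distribution [p] is at most [eps] plus something small
    ([median_near_mass]).  The median can therefore be carried away only if no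
    point has depth noticeably above [eps].  Two facts forbid that for small
    [eps].
    - Every closed halfspace bounded by a hyperplane through the center of [q]
      has [q]-mass at least [1/2], hence [p]-mass at least [(1 - eps) / 2] under
      additive corruption and [1/2 - eps] under total variation corruption.
      These exceed [eps] as long as [eps < 1/3], resp. [eps < 1/4].
    - Every distribution on [R^d] has a point of depth at least [1 / (d + 1)]
      ([centerpoint]), by Helly's theorem for halfspaces and compactness.
      This decides the low dimensions: [1/2] for [d = 1], [1/3] for [d = 2].

    For the converse, uniform distributions on finite lists of points turn
    depth into counting.  The points [u_i = (1, i, ..., i^(d-1))], [i < n], of
    the moment curve and their opposites form a symmetric cloud in which every
    closed halfspace bounded by a hyperplane through the origin contains at most
    [k = n + d - 1] of the [2n] points ([moments_halfspace]).
    - Adding [k] copies of a far point [M] makes [M] a median when [d >= 2]: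
      any other point [x] is cut off by a halfspace that avoids [M] and, after
      an infinitesimal rotation, contains no more of the cloud than a halfspace
      through the origin.  The adversary needs the fraction [k / (2n + k)],
      which tends to [1/3].
    - If [d >= 3] the original distribution also carries [k] copies of a point
      [A] and of [- A], and the adversary moves the copies of [- A] to [M].
      Points off the segment [A, M] are cut off as before, with a direction
      nearly orthogonal to both [A] and [M]; points of the segment are cut off
      from [M] and from the whole cloud by a halfspace that contains only [A].
      The fraction [k / (2n + 2k)] tends to [1/4].
    - In dimension 1, half of the mass at a far point is enough.
    An additive attack is also a total variation attack, which gives the upper
    bounds for total variation in dimensions 1 and 2. *)

(** * The scalar product *)

Section Dot.
Context (R : realType) (d : nat).
Implicit Types v w x y : 'cV[R]_d.

Lemma dotE v x : dot v x = \sum_i v i ord0 * x i ord0.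
Proof. by rewrite /dot mxE; apply: eq_bigr => i _; rewrite mxE. Qed.

Lemma dotC v x : dot v x = dot x v.
Proof. by rewrite !dotE; apply: eq_bigr => i _; rewrite mulrC. Qed.

Lemma dotDr v x y : dot v (x + y) = dot v x + dot v y.
Proof. by rewrite /dot mulmxDr mxE. Qed.

Lemma dotZr v a x : dot v (a *: x) = a * dot v x.
Proof. by rewrite /dot -scalemxAr mxE. Qed.

Lemma dotNr v x : dot v (- x) = - dot v x.
Proof. by rewrite /dot mulmxN mxE. Qed.

Lemma dotBr v x y : dot v (x - y) = dot v x - dot v y.
Proof. by rewrite dotDr dotNr. Qed.

Lemma dotDl v w x : dot (v + w) x = dot v x + dot w x.
Proof. by rewrite dotC dotDr !(dotC x). Qed.

Lemma dotZl a v x : dot (a *: v) x = a * dot v x.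
Proof. by rewrite dotC dotZr (dotC x). Qed.

Lemma dotNl v x : dot (- v) x = - dot v x.
Proof. by rewrite dotC dotNr (dotC x). Qed.

Lemma dot0r v : dot v 0 = 0.
Proof. by rewrite /dot mulmx0 mxE. Qed.

Lemma dot_sumr v (I : finType) (P : pred I) (F : I -> 'cV[R]_d) :
  dot v (\sum_(i | P i) F i) = \sum_(i | P i) dot v (F i).
Proof. by rewrite /dot mulmx_sumr summxE. Qed.

Lemma dot_delta i x : dot (delta_mx i ord0) x = x i ord0.
Proof.
rewrite dotE (bigD1 i) //= big1 => [|j ji]; rewrite mxE !eqxx.
  by rewrite mul1r addr0.
by rewrite (negPf ji) mul0r.
Qed.

Lemma dot_sq_gt0 x : x != 0 -> 0 < dot x x.
Proof.
move=> x0; rewrite lt_def dotE sumr_ge0 ?andbT => [|i _]; last first.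
  by rewrite -expr2 sqr_ge0.
apply: contraNneq x0 => /eqP; rewrite psumr_eq0 => [/allP s0|i _]; last first.
  by rewrite -expr2 sqr_ge0.
apply/eqP/colP => i; rewrite mxE; apply/eqP.
by have := s0 i (mem_index_enum _); rewrite -expr2 sqrf_eq0.
Qed.

End Dot.

Lemma coord_form_continuous (R : realType) m n k (a : 'I_k -> R)
    (f : 'I_k -> 'I_m) (g : 'I_k -> 'I_n) :
  continuous (fun M : 'M[R]_(m, n) => \sum_i a i * M (f i) (g i)).
Proof.
apply: continuous_big => [|i _ x]; first exact: add_continuous.
apply: continuousM; [exact: cst_continuous|exact: coord_continuous].
Qed.

Lemma dot_continuous (R : realType) d (v : 'cV[R]_d) : continuous (dot v).
Proof.
rewrite (_ : dot v = fun x => \sum_i v i ord0 * x i ord0).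
  exact: (@coord_form_continuous R d 1 d _ id (fun=> ord0)).
by apply/funext => x; rewrite dotE.
Qed.

(** * Helly's theorem for halfspaces *)

Section Helly.
Context (R : realType) (d : nat).
Implicit Types h : 'cV[R]_d * R.

Definition in_half h (x : 'cV[R]_d) := dot h.1 x <= h.2.

(** The vectors [(y i, 1)] live in dimension [d + 1], so more than [d + 1] of
    them are linearly dependent; as the coefficients sum to 0 without all
    vanishing, one of them is positive. *)
Lemma affine_dependence n (y : 'I_n -> 'cV[R]_d) : (d.+1 < n)%N ->
  exists c : 'I_n -> R, [/\ \sum_i c i = 0, \sum_i c i *: y i = 0 &
    exists i, 0 < c i].
Proof.
move=> dn.
pose A : 'M[R]_(n, d + 1) := \matrix_i row_mx (y i)^T 1%:M.
have [c c0 cA] : exists2 c : 'rV[R]_n, c != 0 & c *m A = 0.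
  have : kermx A != 0.
    rewrite -mxrank_eq0 mxrank_ker -lt0n subn_gt0.
    by apply: leq_ltn_trans (rank_leq_col _) _; rewrite addn1.
  move=> /rowV0Pn [c]; rewrite sub_kermx => /eqP cA c0.
  by exists c.
have /eqP := cA; rewrite mulmx_sum_row.
under eq_bigr => i _ do rewrite rowK scale_row_mx.
move=> /eqP /rowP e.
have cs : \sum_i c ord0 i = 0.
  have := e (rshift d ord0); rewrite summxE [X in _ = X -> _]mxE => e0.
  rewrite -[RHS]e0.
  by apply: eq_bigr => i _; rewrite row_mxEr !mxE eqxx mulr1.
exists (c ord0); split => //.
  apply/colP => k; rewrite summxE [RHS]mxE.
  have := e (lshift 1 k); rewrite summxE [X in _ = X -> _]mxE => e0.
  rewrite -[RHS]e0; apply: eq_bigr => i _.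
  by rewrite row_mxEl mxE [in RHS]mxE mxE.
apply: contrapT => /forallNP cle; case/negP: c0; apply/eqP/rowP => i.
have {}cle j : c ord0 j <= 0 by rewrite leNgt; apply/negP/cle.
rewrite mxE; apply/eqP; rewrite -oppr_eq0.
have /eqP := cs; rewrite -oppr_eq0 -sumrN psumr_eq0 => [|j _]; last first.
  by rewrite oppr_ge0.
by move=> /allP /(_ i (mem_index_enum _)).
Qed.

(** Induction on the number of halfspaces.  Dropping the [j]-th one leaves a
    family with a common point [y j].  Split an affine dependence [c] of these
    points by sign (Radon): the barycenter of the [y j] with [0 < c j] is also
    the barycenter of the others with weights [- c j].  For each [i] one of the
    two descriptions involves only points [y j] with [j != i], all of which lie
    in the [i]-th halfspace. *)
Lemma helly_halfspaces (F : set ('cV[R]_d * R)) :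
  (forall n (h : 'I_n -> 'cV[R]_d * R), (n <= d.+1)%N ->
     (forall i, F (h i)) -> exists x, forall i, in_half (h i) x) ->
  forall n (h : 'I_n -> 'cV[R]_d * R), (forall i, F (h i)) ->
    exists x, forall i, in_half (h i) x.
Proof.
move=> small; elim=> [|n IH] h Fh; first exact: small.
have [le_n|dn] := leqP n.+1 d.+1; first exact: small.
have /choice [y yP] : forall j : 'I_n.+1, exists x, forall i, in_half (h (lift j i)) x.
  by move=> j; apply: IH => i; exact: Fh.
have {}yP i j : i != j -> dot (h i).1 (y j) - (h i).2 <= 0.
  rewrite eq_sym subr_le0 => /unlift_some [k -> _]; exact: yP.
have [c [cs cy [i0 ci0]]] := affine_dependence y dn.
pose S := \sum_(j | 0 < c j) c j.
have S0 : 0 < S.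
  rewrite /S (bigD1 i0) //=; apply: ltr_pwDl => //.
  by apply: sumr_ge0 => j /andP[/ltW].
exists (S^-1 *: \sum_(j | 0 < c j) c j *: y j) => i.
(* The weighted slack decides membership, and it is 0 when summed over all j. *)
suff : \sum_(j | 0 < c j) c j * (dot (h i).1 (y j) - (h i).2) <= 0.
  under eq_bigr do rewrite mulrBr.
  rewrite sumrB -mulr_suml -/S /in_half dotZr dot_sumr.
  under [in X in _ -> X]eq_bigr do rewrite dotZr.
  by rewrite subr_le0 ler_pdivrMl.
have [ci|ci] := boolP (0 < c i); last first.
  apply: sumr_le0 => j cj.
  apply: mulr_ge0_le0; [exact: ltW|apply: yP].
  by apply: contraNneq ci => ->.
have /eqP : \sum_j c j * (dot (h i).1 (y j) - (h i).2) = 0.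
  under eq_bigr do rewrite mulrBr -dotZr.
  by rewrite sumrB -mulr_suml cs mul0r -dot_sumr cy dot0r subrr.
rewrite (bigID (fun j => 0 < c j)) /= addr_eq0 => /eqP ->.
rewrite -sumrN; apply: sumr_le0 => j; rewrite -leNgt => cj.
rewrite oppr_le0; apply: mulr_le0 => //; apply: yP.
by apply: contraTneq ci => ->; rewrite -leNgt.
Qed.

End Helly.

(** * Measurability of halfspaces and real-valued probabilities *)

Section Borel.
Context (R : realType) (d : nat).

Lemma borel_closed (A : set 'cV[R]_d) :
  closed A -> measurable (A : set (borelRd R d)).
Proof.
move=> /closed_openC oA; rewrite -[A]setCK; apply: measurableC.
exact: sub_sigma_algebra.
Qed.

Lemma borel_halfspace_le (v : 'cV[R]_d) b :
  measurable ([set x : borelRd R d | dot v x <= b]).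
Proof.
apply: (@borel_closed [set x | dot v x <= b]).
apply: (@preimage_closed _ _ (dot v) [set t | t <= b]); last exact: closed_le.
by move=> x _; exact: dot_continuous.
Qed.

Lemma borel_halfspace_ge (v : 'cV[R]_d) b :
  measurable ([set x : borelRd R d | b <= dot v x]).
Proof.
rewrite (_ : [set _ | _] = [set x : borelRd R d | dot (- v) x <= - b]).
  exact: borel_halfspace_le.
by apply/seteqP; split=> x /=; rewrite dotNl lerN2.
Qed.

Lemma borel_halfspace (v mu : 'cV[R]_d) :
  measurable ([set x : borelRd R d | 0 <= dot v (x - mu)]).
Proof.
rewrite (_ : [set _ | _] = [set x : borelRd R d | dot v mu <= dot v x]).
  exact: borel_halfspace_ge.
by apply/seteqP; split=> x /=; rewrite dotBr subr_ge0.
Qed.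

Lemma borel_norm_ge (b : R) : measurable ([set x : borelRd R d | b <= `|x : 'cV[R]_d|]).
Proof.
apply: (@borel_closed [set x | b <= `|x|]).
apply: (@preimage_closed _ _ (fun x : 'cV[R]_d => `|x|) [set t | b <= t]).
  by move=> x _; exact: norm_continuous.
exact: closed_ge.
Qed.

End Borel.
#[local] Hint Resolve borel_halfspace borel_halfspace_le borel_halfspace_ge
  borel_norm_ge : core.

Section Prob.
Context (R : realType) (d : nat) (p : distr R d).

Definition pr (A : set (borelRd R d)) : R := fine (p A).

Lemma prE A : measurable A -> p A = (pr A)%:E.
Proof. by move=> mA; rewrite /pr fineK // fin_num_measure. Qed.

Lemma pr_ge0 A : 0 <= pr A.
Proof. by rewrite fine_ge0. Qed.

Lemma prT : pr setT = 1.
Proof. by rewrite /pr probability_setT. Qed.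

Lemma pr_setC A : measurable A -> pr (~` A) = 1 - pr A.
Proof.
move=> mA; apply: EFin_inj; rewrite -prE ?probability_setC ?prE //.
exact: measurableC.
Qed.

Lemma le_pr A B : measurable A -> measurable B -> A `<=` B -> pr A <= pr B.
Proof. by move=> mA mB AB; rewrite -lee_fin -!prE // le_measure // inE. Qed.

Lemma pr_le1 A : measurable A -> pr A <= 1.
Proof. by move=> mA; rewrite -prT; apply: le_pr. Qed.

Lemma prU A B : measurable A -> measurable B -> pr (A `|` B) <= pr A + pr B.
Proof.
move=> mA mB; rewrite -lee_fin EFinD -!prE //; last exact: measurableU.
exact: measureU2.
Qed.

Lemma pr_cover n (A : 'I_n -> set (borelRd R d)) :
  (forall i, measurable (A i)) -> (forall x, exists i, A i x) ->
  1 <= \sum_i pr (A i).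
Proof.
move=> mA cA; have <- : pr (\big[setU/set0]_i A i) = 1.
  rewrite -prT -bigcup_seq; congr pr; apply/seteqP; split => // x _.
  by have [i Aix] := cA x; exists i => //=; rewrite mem_index_enum.
suff [] : measurable (\big[setU/set0]_i A i) /\
    pr (\big[setU/set0]_i A i) <= \sum_i pr (A i) by [].
elim/big_ind2 : _ => [|A1 x A2 y [m1 l1] [m2 l2]|i _].
- by split => //; rewrite /pr measure0.
- split; first exact: measurableU.
  by apply: (le_trans (prU m1 m2)); rewrite lerD.
- by [].
Qed.

Lemma pr_bigcup_gt (F : (set (borelRd R d))^nat) (c : R) :
  (forall n, measurable (F n)) -> (forall n m, (n <= m)%N -> F n `<=` F m) ->
  c < pr (\bigcup_n F n) -> exists n, c < pr (F n).
Proof.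
move=> mF ndF cF.
have mU : measurable (\bigcup_n F n) by exact: bigcupT_measurable.
have ndF' : {homo F : n m / (n <= m)%N >-> (n <= m)%O}.
  by move=> n m nm; apply/subsetPset/ndF.
have : p (F n) @[n --> \oo] --> (pr (\bigcup_n F n))%:E.
  by rewrite -prE //; exact: nondecreasing_cvg_mu.
move=> /fine_cvgP [_].
move=> /(cvgr_gt (pr (\bigcup_n F n))) /(_ _ cF) [n _ /(_ n)] /= cn.
by exists n; apply: cn => /=.
Qed.

Lemma pr_norm_large (c : R) : 0 < c ->
  exists n : nat, pr [set x | n%:R <= `|x : 'cV[R]_d|] < c.
Proof.
move=> c0; pose F n := ~` [set x : borelRd R d | n%:R <= `|x : 'cV[R]_d|].
have mF n : measurable (F n) by apply: measurableC.
have FT : \bigcup_n F n = setT.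
  apply/seteqP; split=> // x _; exists (Num.bound `|x : 'cV[R]_d|) => //.
  by apply/negP; rewrite -ltNge archi_boundP.
have [n m nm||n] := @pr_bigcup_gt F (1 - c) mF.
- by move=> x nx mx; apply: nx; apply: le_trans mx; rewrite ler_nat.
- by rewrite FT prT gtrBl.
by rewrite pr_setC // ltrD2l ltrN2 => ?; exists n.
Qed.

End Prob.

Lemma coord_le_norm (R : realType) d (x : 'cV[R]_d) i : `|x i ord0| <= `|x|.
Proof.
rewrite [leRHS]/Num.norm /= mx_normrE; apply/bigmax_geP; right => /=.
by exists (i, ord0).
Qed.

Lemma norm_gt_coord (R : realType) d (x : 'cV[R]_d) r :
  0 <= r -> r < `|x| -> exists i, r < `|x i ord0|.
Proof.
move=> r0; rewrite [ltRHS]/Num.norm /= mx_normrE => /bigmax_gtP [|[[i j] _ /=]].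
  by rewrite ltNge r0.
by rewrite (ord1 j); exists i.
Qed.

(** * Depth and the centerpoint theorem *)

Section Depth.
Context (R : realType) (d : nat) (p : distr R d).
Implicit Types (mu v : 'cV[R]_d).

Definition halfspace v mu : set (borelRd R d) := [set x | 0 <= dot v (x - mu)].

Lemma depth_le mu v : (tukey_depth mu p <= (pr p (halfspace v mu))%:E)%E.
Proof.
rewrite -prE; last exact: borel_halfspace.
by apply: ereal_inf_lbound; exists v.
Qed.

Lemma depth_ge mu (c : R) : (forall v, c <= pr p (halfspace v mu)) ->
  (c%:E <= tukey_depth mu p)%E.
Proof.
move=> cp; apply: le_ereal_inf_tmp => _ [v _ <-].
by rewrite prE ?lee_fin; [exact: cp|exact: borel_halfspace].
Qed.

(** The threshold is such that the complements of any [d + 1] heavy halfspaces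
    have total mass less than 1. *)
Definition heavy : set ('cV[R]_d * R) :=
  [set h | 1 - d.+1%:R^-1 < pr p [set x | dot h.1 x <= h.2]].

(** At most [d + 1] heavy halfspaces meet, since their complements cannot cover
    the space; Helly's theorem extends this to all finite families. *)
Lemma heavy_halfspaces_meet (s : seq ('cV[R]_d * R)) :
  (forall h, h \in s -> heavy h) -> exists x, forall h, h \in s -> in_half h x.
Proof.
move=> sH.
have [n h nd hH|i|x xP] := @helly_halfspaces _ _ heavy _ (size s) (tnth (in_tuple s)).
- apply: contrapT => /forallNP no.
  have := @pr_cover _ _ p n (fun i => ~` [set x | dot (h i).1 x <= (h i).2]).
  move=> /(_ (fun i => measurableC (borel_halfspace_le _ _))).
  move=> /(_ (fun x => (existsNP _).2 (no x))).
  case: n h nd hH {no} => [|n] h nd hH; first by rewrite big_ord0 ler10.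
  apply/negP; rewrite -ltNge.
  have : \sum_(i < n.+1) pr p (~` [set x | dot (h i).1 x <= (h i).2])
      < \sum_(i < n.+1) d.+1%:R^-1.
    apply: ltr_sum => [|i _]; first by apply/hasP; exists ord0; rewrite ?mem_index_enum.
    rewrite pr_setC; last exact: borel_halfspace_le.
    by rewrite ltrBlDr -ltrBlDl; exact: hH.
  move=> /lt_le_trans; apply.
  by rewrite sumr_const card_ord -[leLHS]mulr_natl ler_pdivrMr // mul1r ler_nat.
- by apply: sH; exact: mem_tnth.
- exists x => _ /(tnthP (in_tuple s)) [i ->]; exact: xP.
Qed.

(** The sides of a large box are heavy halfspaces, so by compactness of the box
    all heavy halfspaces have a common point.  If a closed halfspace through
    that point had mass below [1 / (d + 1)], the complementary open halfspace
    would contain a heavy closed halfspace missing the point. *)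
Lemma centerpoint : exists mu, ((d.+1%:R^-1)%:E <= tukey_depth mu p)%E.
Proof.
have c0 : 0 < d.+1%:R^-1 :> R by rewrite invr_gt0.
have [M HM] := pr_norm_large p c0.
have heavyM v : (forall x, dot v x <= `|x|) -> heavy (v, M%:R).
  move=> vx; rewrite /heavy /=.
  have : 1 - d.+1%:R^-1 < pr p (~` [set x | M%:R <= `|x : 'cV[R]_d|]).
    by rewrite pr_setC ?ltrD2l ?ltrN2.
  move=> /lt_le_trans; apply; apply: le_pr.
  - exact: measurableC.
  - exact: borel_halfspace_le.
  - move=> x /= /negP; rewrite -ltNge => /ltW; exact: le_trans.
pose box := [seq (delta_mx i ord0 : 'cV[R]_d, M%:R : R) | i : 'I_d] ++
            [seq (- delta_mx i ord0 : 'cV[R]_d, M%:R : R) | i : 'I_d].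
have boxH h : h \in box -> heavy h.
  rewrite mem_cat => /orP[] /mapP [i _ ->]; apply: heavyM => x.
    by rewrite dot_delta (le_trans (ler_norm _)) // coord_le_norm.
  by rewrite dotNl dot_delta (le_trans (ler_norm _)) // normrN coord_le_norm.
(* [rV_compact] is about row vectors, hence the transposes. *)
pose K := [set r : 'rV[R]_d | forall i, `[- M%:R, M%:R]%classic (r ord0 i)].
have cK : compact K.
  apply: (@rV_compact R d (fun=> `[- M%:R, M%:R]%classic)) => i.
  exact: segment_compact.
pose g (h : 'cV[R]_d * R) := [set r : 'rV[R]_d | \sum_i h.1 i ord0 * r ord0 i <= h.2].
have gE h x : g h x^T = (in_half h x).
  by rewrite /g /in_half /= dotE; under eq_bigr do rewrite mxE.
move: cK; rewrite compact_In0 => /(_ _ heavy (fun h => K `&` g h)) [].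
- exists g => // h _.
  pose f (r : 'rV[R]_d) := \sum_i h.1 i ord0 * r ord0 i.
  apply: (@preimage_closed _ _ f [set t | t <= h.2]); last exact: closed_le.
  move=> x _; exact: (@coord_form_continuous R 1 d d (fun i => h.1 i ord0)
    (fun=> ord0) id).
- move=> D DH.
  have [|x xP] := @heavy_halfspaces_meet (finmap.enum_fset D ++ box).
    move=> h; rewrite mem_cat => /orP[/DH|/boxH //]; by rewrite inE.
  exists x^T => h /= hD; split; last first.
    by rewrite gE; apply: xP; rewrite mem_cat hD.
  move=> i; rewrite /= in_itv /= mxE lerNl; apply/andP; split.
    have := xP (- delta_mx i ord0, M%:R); rewrite /in_half /= dotNl dot_delta; apply.
    rewrite !mem_cat; apply/orP; right; apply/orP; right.
    by apply/mapP; exists i; rewrite ?mem_enum.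
  have := xP (delta_mx i ord0, M%:R); rewrite /in_half /= dot_delta; apply.
  rewrite !mem_cat; apply/orP; right; apply/orP; left.
  by apply/mapP; exists i; rewrite ?mem_enum.
- move=> r rP; exists r^T; apply: depth_ge => v; rewrite leNgt; apply/negP => small.
  have half_in h : heavy h -> in_half h r^T.
    by move=> hh; rewrite -gE trmxK; case: (rP h hh).
  (* Closed halfspaces exhausting the open halfspace that misses the point. *)
  pose F n := [set x : borelRd R d | dot v x <= dot v r^T - n.+1%:R^-1].
  have FE : \bigcup_n F n = ~` halfspace v r^T.
    apply/seteqP; split=> x /=.
      move=> [n _]; rewrite /F /halfspace /= dotBr => Fn; apply/negP; rewrite -ltNge.
      by rewrite subr_lt0 (le_lt_trans Fn) // gtrBl invr_gt0.
    move=> /negP; rewrite -ltNge dotBr subr_lt0 -subr_gt0 => e0.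
    have [n _ /(_ n)] := near_infty_natSinv_lt (PosNum e0).
    move=> /(_ (leqnn n)) /= ne; exists n => //=.
    by rewrite /F /=; rewrite lerBrDl -lerBrDr ltW.
  have [n|n m nm x||n] := @pr_bigcup_gt _ _ p F (1 - d.+1%:R^-1).
  - exact: borel_halfspace_le.
  - rewrite /F /= => /le_trans; apply; rewrite lerD2l lerN2.
    by rewrite lef_pV2 ?posrE // ler_nat.
  - by rewrite FE pr_setC ?ltrD2l ?ltrN2 //; exact: borel_halfspace.
  - move=> /(half_in (v, _)); rewrite /in_half /=.
    by apply/negP; rewrite -ltNge gtrBl invr_gt0.
Qed.

End Depth.

(** * Halfspace-symmetric distributions *)

Section Symmetric.
Context (R : realType) (d : nat) (q : distr R d).

Definition sym_center (mu : 'cV[R]_d) := forall (v : 'cV[R]_d) (B : set R),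
  measurable B ->
  pushforward q (fun x : borelRd R d => dot v (x - mu)) B =
  pushforward q (fun x : borelRd R d => - dot v (x - mu)) B.

Context (mu : 'cV[R]_d) (qmu : sym_center mu).

Lemma sym_center_halfspaceN v :
  pr q (halfspace (- v) mu) = pr q (halfspace v mu).
Proof.
have := @qmu v `[0, +oo[%classic (measurable_itv _).
rewrite /pushforward /pr => e; congr fine; rewrite /halfspace.
transitivity (q ((fun x => - dot v (x - mu)) @^-1` `[0, +oo[%classic)); first congr (q _).
  by apply/seteqP; split=> x; rewrite /= in_itv /= andbT dotNl.
rewrite -e; congr (q _).
by apply/seteqP; split=> x; rewrite /= in_itv /= andbT.
Qed.

(** Two opposite closed halfspaces cover the space and have equal mass. *)
Lemma sym_center_half v : 1 / 2 <= pr q (halfspace v mu).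
Proof.
have := prU q (borel_halfspace v mu) (borel_halfspace (- v) mu).
rewrite -/(halfspace v mu) -/(halfspace (- v) mu) sym_center_halfspaceN.
rewrite (_ : _ `|` _ = setT) ?prT; first lra.
apply/seteqP; split=> // x _ /=; rewrite /halfspace /= dotNl oppr_ge0.
by case: (leP 0 (dot v (x - mu))) => [|/ltW]; [left|right].
Qed.

(** For a point [nu] and a direction [v], the halfspace at [nu] in direction [v]
    or in direction [- v] is contained in the parallel one at the center. *)
Lemma sym_center_median : tukey_median q mu.
Proof.
move=> nu; apply: le_ereal_inf_tmp => _ [v _ <-].
rewrite -/(halfspace v mu) prE; last exact: borel_halfspace.
have key w : 0 <= dot w (nu - mu) ->
    (tukey_depth nu q <= (pr q (halfspace w mu))%:E)%E.
  move=> w0; apply: (le_trans (depth_le q nu w)); rewrite lee_fin.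
  apply: le_pr; try exact: borel_halfspace.
  move=> x; rewrite /halfspace /= !dotBr !subr_ge0 => vx.
  by apply: le_trans vx; rewrite -subr_ge0 -dotBr.
have [/key //|/ltW] := leP 0 (dot v (nu - mu)).
by rewrite -oppr_ge0 -dotNl => /key; rewrite sym_center_halfspaceN.
Qed.

End Symmetric.

(** * Lower bounds on the breakdown points *)

(** A point outside the ball of radius [n] for the sup norm has a coordinate
    exceeding [n] in absolute value; the halfspace beyond it in that coordinate
    direction lies outside the ball, where [p] has mass less than [c]. *)
Lemma median_near_mass (R : realType) d (p q : distr R d) (eps c : R) n x :
  (forall A, measurable A -> pr p A <= pr q A + eps) ->
  pr q [set z | n%:R <= `|z : 'cV[R]_d|] + eps < c ->
  (exists nu, (c%:E <= tukey_depth nu p)%E) ->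
  tukey_median p x -> `|x| <= n%:R.
Proof.
move=> pq qn [nu cnu] px; rewrite leNgt; apply/negP => /norm_gt_coord [] // i ni.
have : (c%:E <= (pr p (halfspace (Num.sg (x i ord0) *: delta_mx i ord0) x))%:E)%E.
  by apply: (le_trans cnu); apply: (le_trans (px nu)); exact: depth_le.
rewrite lee_fin => /(lt_le_trans qn); apply/negP; rewrite -leNgt.
apply: le_trans (pq _ (@borel_norm_ge R d n%:R)).
apply: le_pr; [exact: borel_halfspace|exact: borel_norm_ge|].
move=> z; rewrite /halfspace /= dotZl dot_delta !mxE mulrBr subr_ge0 => h.
apply: (ltW (lt_le_trans ni _)); rewrite normrEsg.
apply: (le_trans h); apply: le_trans (coord_le_norm z i).
apply: (le_trans (ler_norm _)); rewrite normrM ler_piMl // normr_sg.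
by case: eqP.
Qed.

Section Norm.
Context (R : realType) (d : nat) (N : 'cV[R]_d -> R) (hN : is_norm N).

Lemma is_norm0 : N 0 = 0.
Proof. by rewrite -[X in N X](scale0r 0) (norm_homogeneous hN) normr0 mul0r. Qed.

Lemma is_norm_ge0 x : 0 <= N x.
Proof.
have := norm_triangle hN x (- x); rewrite subrr is_norm0.
by rewrite -scaleN1r (norm_homogeneous hN) normrN1 mul1r -mulr2n pmulrn_lge0.
Qed.

Lemma is_norm_gt0 x : x != 0 -> 0 < N x.
Proof.
rewrite lt_def is_norm_ge0 andbT; apply: contra_neq; exact: norm_definite.
Qed.

Lemma is_norm_bounded : exists2 C, 0 <= C & forall x, N x <= C * `|x|.
Proof.
exists (\sum_i N (delta_mx i ord0)) => [|x].
  by apply: sumr_ge0 => i _; exact: is_norm_ge0.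
have {1}-> : x = \sum_i x i ord0 *: delta_mx i ord0.
  by rewrite {1}(matrix_sum_delta x); apply: eq_bigr => i _; rewrite big_ord1.
rewrite mulr_suml.
elim/big_ind2 : _ => [|x1 y1 x2 y2 h1 h2|i _].
- by rewrite is_norm0.
- by apply: (le_trans (norm_triangle hN _ _)); rewrite lerD.
- rewrite (norm_homogeneous hN) mulrC ler_wpM2l ?is_norm_ge0 //.
  exact: coord_le_norm.
Qed.

(** The maximum bias is finite if the corruption adds at most [eps] to the mass
    of any event and always leaves a point of depth more than [eps].  The
    medians of [q] itself are bounded for the same reason, with no corruption
    and the center as the deep point. *)
Lemma max_bias_finite (q : distr R d) mu (C : set (distr R d)) (eps c : R) :
  sym_center q mu -> eps < c ->
  (forall p A, C p -> measurable A -> pr p A <= pr q A + eps) ->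
  (forall p, C p -> exists nu, (c%:E <= tukey_depth nu p)%E) ->
  max_bias N C q != +oo%E.
Proof.
move=> qmu ec Cq Cd; have [K K0 NK] := is_norm_bounded.
have [|n qn] := @pr_norm_large _ _ q (c - eps); first by rewrite subr_gt0.
have [|m qm] := @pr_norm_large _ _ q (1 / 2); first lra.
rewrite -ltey; apply: (@le_lt_trans _ _ (K * (n%:R + m%:R))%:E); last exact: ltry.
apply: ge_ereal_sup => _ [p [x [y [Cp px qy ->]]]].
rewrite lee_fin; apply: (le_trans (NK _)); rewrite ler_wpM2l //.
apply: (le_trans (ler_normB _ _)); rewrite lerD //.
  by apply: (median_near_mass (fun A => Cq p A Cp) _ (Cd p Cp) px); rewrite -ltrBrDr.
apply: (@median_near_mass _ _ q q 0 (1 / 2) m) qy => [A _||].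
- by rewrite addr0.
- by rewrite addr0.
- by exists mu; apply: depth_ge; exact: sym_center_half.
Qed.

Lemma corrupt_add_mixture (q p : distr R d) eps : corrupt_add q eps p ->
  exists r : distr R d, forall A, measurable A ->
    pr p A = (1 - eps) * pr q A + eps * pr r A.
Proof.
move=> [r rP]; exists r => A mA; apply: EFin_inj.
by rewrite -prE // rP // !prE.
Qed.

Lemma corrupt_TV_le (q p : distr R d) eps : corrupt_TV q eps p ->
  forall A, measurable A -> pr q A <= pr p A + eps.
Proof.
move=> qp A mA; rewrite -lerBlDl -lee_fin; apply: le_trans qp.
by apply: ereal_sup_ubound; exists A => //; rewrite EFinB -!prE.
Qed.

(** The deep point is the center, of depth [(1 - eps) / 2 > eps], or else a
    centerpoint. *)
Lemma breakdown_add_ge c : c <= 1 / 3 \/ c <= d.+1%:R^-1 ->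
  (c%:E <= family_breakdown_add N (@halfspace_symmetric R d))%E.
Proof.
move=> hc; apply: le_ereal_inf_tmp => _ [q [mu qmu] <-].
apply: le_ereal_inf_tmp => _ [eps [/andP[e0 e1] be] <-].
rewrite lee_fin leNgt; apply/negP => ec.
have leC p A : corrupt_add q eps p -> measurable A -> pr p A <= pr q A + eps.
  move=> /corrupt_add_mixture [r rP] mA; rewrite rP //.
  have := pr_le1 r mA; have := pr_ge0 q A; nra.
case: hc => hc.
  suff : bias_add N q eps != +oo%E by rewrite be.
  apply: (max_bias_finite qmu _ leC (c := (1 - eps) / 2)); first lra.
  move=> p /corrupt_add_mixture [r rP]; exists mu; apply: depth_ge => v.
  rewrite rP; last exact: borel_halfspace.
  have := sym_center_half qmu v; have := pr_ge0 r (halfspace v mu); nra.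
suff : bias_add N q eps != +oo%E by rewrite be.
apply: (max_bias_finite qmu _ leC (c := d.+1%:R^-1)); first exact: lt_le_trans hc.
by move=> p _; exact: centerpoint.
Qed.

(** The deep point is the center, of depth [1 / 2 - eps > eps], or else a
    centerpoint. *)
Lemma breakdown_TV_ge c : c <= 1 / 4 \/ c <= d.+1%:R^-1 ->
  (c%:E <= family_breakdown_TV N (@halfspace_symmetric R d))%E.
Proof.
move=> hc; apply: le_ereal_inf_tmp => _ [q [mu qmu] <-].
apply: le_ereal_inf_tmp => _ [eps be <-].
rewrite lee_fin leNgt; apply/negP => ec.
have leC p A : corrupt_TV q eps p -> measurable A -> pr p A <= pr q A + eps.
  move=> /corrupt_TV_le qp mA; have := qp _ (measurableC mA).
  rewrite !pr_setC //; lra.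
case: hc => hc.
  suff : bias_TV N q eps != +oo%E by rewrite be.
  apply: (max_bias_finite qmu _ leC (c := 1 / 2 - eps)); first lra.
  move=> p /corrupt_TV_le qp; exists mu; apply: depth_ge => v.
  have := sym_center_half qmu v; have := qp _ (borel_halfspace v mu).
  rewrite -/(halfspace v mu); lra.
suff : bias_TV N q eps != +oo%E by rewrite be.
apply: (max_bias_finite qmu _ leC (c := d.+1%:R^-1)); first exact: lt_le_trans hc.
by move=> p _; exact: centerpoint.
Qed.

End Norm.

(** * Uniform distributions on finite lists *)

Section Empirical.
Context (R : realType) (d : nat).
Implicit Types (s : seq 'cV[R]_d).

Definition freq s (A : set 'cV[R]_d) : R :=
  (count (fun x => x \in A) s)%:R / (size s)%:R.

Definition empirical (x0 : 'cV[R]_d) s : set (borelRd R d) -> \bar R :=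
  mscale ((size s)%:R^-1 : R)%:nng
    (msum (fun i => @dirac _ (borelRd R d) (nth x0 s i) R) (size s)).

HB.instance Definition _ x0 s := Measure.on (empirical x0 s).

Lemma empiricalE x0 s A : empirical x0 s A = (freq s A)%:E.
Proof.
rewrite /empirical /mscale /msum /freq mulrC EFinM; congr (_ * _)%E.
transitivity (\sum_(x <- s) @dirac _ (borelRd R d) x R A)%E.
  by rewrite (big_nth x0) big_mkord.
elim: s => [|x s IH]; first by rewrite big_nil.
by rewrite big_cons IH diracE /= natrD EFinD.
Qed.

Lemma empirical_exists s : (0 < size s)%N ->
  exists q : distr R d, forall A, q A = (freq s A)%:E.
Proof.
case: s => // x0 s _.
have pT : empirical x0 (x0 :: s) setT = 1%E.
  rewrite empiricalE /freq (eq_count (a2 := predT)) ?count_predT ?divff //.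
    by rewrite pnatr_eq0.
  by move=> x; rewrite /= in_setT.
pose mixin := Measure_isProbability.Build _ _ _ (empirical x0 (x0 :: s)) pT.
pose q : distr R d := HB.pack (empirical x0 (x0 :: s)) mixin.
by exists q => A; exact: empiricalE.
Qed.

Lemma pr_empirical (q : distr R d) s A : (forall A, q A = (freq s A)%:E) ->
  pr q A = freq s A.
Proof. by move=> qs; rewrite /pr qs. Qed.

Lemma empirical_sym_center (q : distr R d) s :
  (forall A, q A = (freq s A)%:E) -> perm_eq [seq - x | x <- s] s ->
  sym_center q 0.
Proof.
move=> qs sN v B _; rewrite /pushforward !qs /freq; congr ((_%:R / _)%:E).
rewrite -(permP sN) count_map; apply: eq_count => x /=; apply/idP/idP;
  by rewrite !inE /= !subr0 dotNr.
Qed.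

(** Every closed halfspace at [M] contains the [k] copies of [M]. *)
Lemma empirical_median (p : distr R d) s (M : 'cV[R]_d) k :
  (forall A, p A = (freq s A)%:E) -> (k <= count_mem M s)%N ->
  (forall x, x != M ->
     exists v, (count (fun z => (0 <= dot v (z - x))%R) s <= k)%N) ->
  tukey_median p M.
Proof.
move=> ps kM far x; have [->//|/far [v vk]] := eqVneq x M.
apply: (@le_trans _ _ (k%:R / (size s)%:R)%:E).
  apply: (le_trans (depth_le _ _ v)); rewrite lee_fin (pr_empirical _ ps) /freq.
  rewrite ler_wpM2r ?invr_ge0 // ler_nat (leq_trans _ vk) //.
  by apply: sub_count => z; rewrite inE.
apply: depth_ge => w; rewrite (pr_empirical _ ps) /freq.
rewrite ler_wpM2r ?invr_ge0 // ler_nat (leq_trans kM) //.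
by apply: sub_count => z /eqP ->; rewrite inE /halfspace /= subrr dot0r.
Qed.

Lemma empirical_corrupt_add (q p : distr R d) s (M : 'cV[R]_d) k :
  (0 < size s)%N ->
  (forall A, q A = (freq s A)%:E) -> (forall A, p A = (freq (s ++ nseq k M) A)%:E) ->
  corrupt_add q (k%:R / (size s + k)%:R) p.
Proof.
move=> s0 qs ps; have [//|r rM] := @empirical_exists [:: M].
exists r => A _; rewrite qs ps rM /freq count_cat size_cat count_nseq size_nseq /=.
rewrite -!EFinM -EFinD; congr (_%:E).
rewrite divr1 addn0 !natrD natrM.
have s0' : 0 < (size s)%:R :> R by rewrite ltr0n.
have k0 : 0 <= k%:R :> R by [].
by field; apply/andP; split; rewrite lt0r_neq0 ?ltr_wpDr.
Qed.

Lemma corrupt_add_TV (q p : distr R d) eps : 0 <= eps ->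
  corrupt_add q eps p -> corrupt_TV q eps p.
Proof.
move=> e0 /corrupt_add_mixture [r rP]; apply: ge_ereal_sup => _ [A mA <-].
rewrite !prE // -EFinB lee_fin rP //.
have := pr_ge0 r A; have := pr_le1 q mA; nra.
Qed.

Lemma max_bias_infty N (hN : is_norm N) (q : distr R d) (C : set (distr R d)) :
  sym_center q 0 ->
  (forall L, exists p M, [/\ C p, tukey_median p M & L <= N M]) ->
  max_bias N C q = +oo%E.
Proof.
move=> q0 far; apply/eqyP => L _.
have [p [M [Cp pM LM]]] := far L.
apply: le_ereal_sup_tmp; exists (N M)%:E; last by rewrite lee_fin.
by exists p, M, 0; rewrite subr0; split => //; exact: sym_center_median.
Qed.

End Empirical.

(** * The symmetrized moment curve and its light halfspaces *)

Section Geometry.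
Context (R : realType) (d : nat).
Implicit Types (v w g x : 'cV[R]_d).

Definition moment (i : nat) : 'cV[R]_d := \col_(j < d) (i%:R ^+ j).

Definition moments n : seq 'cV[R]_d :=
  [seq moment i | i <- iota 0 n] ++ [seq - moment i | i <- iota 0 n].

Lemma size_moments n : size (moments n) = (n + n)%N.
Proof. by rewrite size_cat !size_map size_iota. Qed.

Lemma moments_sym n : perm_eq [seq - x | x <- moments n] (moments n).
Proof.
rewrite /moments map_cat -!map_comp perm_catC; apply/permP => a.
rewrite !count_cat; congr (count a _ + count a _)%N.
by apply: eq_map => i /=; rewrite opprK.
Qed.

(** On the moment curve the form [dot v] is a nonzero polynomial of degree less
    than [d] in the parameter. *)
Lemma moment_on_hyperplane v n : v != 0 ->
  (count (fun i => (dot v (moment i) == 0)%R) (iota 0 n) <= d.-1)%N.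
Proof.
move=> v0; pose P : {poly R} := \sum_(j < d) (v j ord0)%:P * 'X^j.
have PE i : P.[i%:R] = dot v (moment i).
  rewrite horner_sum dotE; apply: eq_bigr => j _.
  by rewrite hornerM hornerC hornerXn mxE.
have P0 : P != 0.
  apply: contraNneq v0 => P0; apply/eqP/colP => j; rewrite [RHS]mxE.
  have <- : P`_j = v j ord0; last by rewrite P0 coef0.
  rewrite coef_sum (bigD1 j) //= big1 => [|i ij].
    by rewrite coefCM coefXn eqxx mulr1 addr0.
  by rewrite coefCM coefXn eq_sym -val_eqE /= in ij *; rewrite (negPf ij) mulr0.
have sP : (size P <= d)%N.
  apply: (leq_trans (size_sum _ _ _)); apply/bigmax_leqP => j _.
  apply: (leq_trans (size_polyMleq _ _)); rewrite size_polyXn addnS /=.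
  by rewrite (leq_trans _ (ltn_ord j)) // -[leqRHS]add1n leq_add2r size_polyC leq_b1.
pose rs : seq R := [seq i%:R | i <- iota 0 n & dot v (moment i) == 0].
have : (size rs < size P)%N.
  apply: max_poly_roots => //.
    apply/allP => _ /mapP [i + ->]; rewrite mem_filter => /andP[e _].
    by rewrite rootE PE.
  rewrite map_inj_uniq ?filter_uniq ?iota_uniq //.
  by move=> i j /eqP; rewrite eqr_nat => /eqP.
rewrite size_map size_filter => /leq_trans /(_ sP) rd.
by rewrite -ltnS (leq_trans rd (leqSpred d)).
Qed.

(** A closed halfspace through 0 contains exactly one point of each opposite
    pair, except for the pairs that lie on the bounding hyperplane. *)
Lemma moments_halfspace v n : v != 0 ->
  (count (fun z => (0 <= dot v z)%R) (moments n) <= n + d.-1)%N.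
Proof.
move=> v0; rewrite count_cat !count_map -count_predUI.
apply: leq_add; first by rewrite (leq_trans (count_size _ _)) // size_iota.
apply: leq_trans (moment_on_hyperplane n v0); apply: sub_count => i /=.
by rewrite dotNr oppr_ge0 => /andP[a b]; rewrite eq_le a b.
Qed.

(** Finitely many strict inequalities survive a common small perturbation.  The
    induction needs the stronger claim that all smaller steps work as well. *)
Lemma small_step (T : eqType) (a b : T -> R) (s : seq T) :
  exists2 e, 0 < e & forall z, z \in s -> a z < 0 -> a z + e * b z < 0.
Proof.
suff [e e0 he] : exists2 e, 0 < e & forall e', 0 < e' <= e ->
    forall z, z \in s -> a z < 0 -> a z + e' * b z < 0.
  by exists e => //; apply: he; rewrite e0 lexx.
elim: s => [|z s [e e0 IH]]; first by exists 1.
have [az|az] := ltP (a z) 0; last first.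
  exists e => // e' he y; rewrite inE => /orP[/eqP ->|]; first by rewrite ltNge az.
  exact: IH.
have B0 : 0 < `|b z| + 1 by rewrite ltr_wpDl.
(* The 1 makes the denominator positive, the 2 makes the inequality strict. *)
exists (Num.min e (- a z / (`|b z| + 1) / 2)).
  by rewrite lt_min e0 !divr_gt0 // oppr_gt0.
move=> e' /andP[e'0]; rewrite le_min => /andP[e'e e'z] y.
rewrite inE => /orP[/eqP -> _|ys]; last by apply: IH => //; rewrite e'0.
rewrite -mulrA -invfM ler_pdivlMr ?mulr_gt0 // in e'z.
have := ler_norm (b z); nra.
Qed.

(** A segment that avoids 0 lies in an open halfspace.  Let [h] be [dot m m]
    times the component of [a] orthogonal to [m].  If it vanishes then [a] and
    [m] are parallel and point the same way.  Otherwise [- h] is negative on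
    [a] and zero on [m], and a small multiple of [- m] makes it negative on
    both. *)
Lemma separate_pair (a m : 'cV[R]_d) :
  (forall t, 0 <= t <= 1 -> (1 - t) *: a + t *: m != 0) ->
  exists g, dot g a < 0 /\ dot g m < 0.
Proof.
move=> am.
have m0 : m != 0.
  by have := am 1; rewrite subrr scale0r add0r scale1r; apply; rewrite ler01 lexx.
have mm := dot_sq_gt0 m0.
pose h := dot m m *: a - dot a m *: m.
have hm : dot h m = 0 by rewrite /h dotDl dotNl !dotZl; ring.
have [h0|h0] := eqVneq h 0.
  have [amp|amn] := ltP 0 (dot a m).
    by exists (- m); rewrite !dotNl (dotC m a) !oppr_lt0.
  have D0 : 0 < dot m m - dot a m by lra.
  (* The parameter at which dot m vanishes on the segment from a to m. *)
  pose t := - dot a m / (dot m m - dot a m).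
  have t01 : 0 <= t <= 1.
    by rewrite /t ler_pdivlMr // mul0r ler_pdivrMr // mul1r; lra.
  have /negP[] := am t t01.
  rewrite -(inj_eq (scalerI (lt0r_neq0 mm))) scaler0 scalerDr !scalerA.
  rewrite [_ * (1 - t)]mulrC -(scalerA (1 - t)); move/eqP: h0.
  rewrite subr_eq0 => /eqP ->.
  rewrite scalerA -scalerDl (_ : _ + _ = 0) ?scale0r //.
  by rewrite /t; field; rewrite lt0r_neq0.
have ha : 0 < dot h a.
  have : 0 < dot h (dot m m *: a).
    suff -> : dot h (dot m m *: a) = dot h h by exact: dot_sq_gt0.
    by rewrite {3}/h dotBr (dotZr h (dot a m)) hm mulr0 subr0.
  by rewrite dotZr pmulr_rgt0.
have [e e0 he] := small_step (fun _ : unit => - dot h a) (fun _ => - dot a m) [:: tt].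
exists (- h - e *: m); rewrite !dotDl !dotNl !dotZl hm (dotC m a); split.
  by have := he tt; rewrite inE eqxx mulrN oppr_lt0; apply.
by rewrite oppr0 sub0r oppr_lt0 mulr_gt0.
Qed.

(** Perturb [w], which vanishes on [S], by a small multiple of [g], which is
    smaller on [S] than at [x].  The halfspace at [x] then misses [S].  As
    [0 <= dot w x] can be assumed by changing the sign of [w], a point of [B]
    with [dot w z < 0] stays outside, so the halfspace contains no more of [B]
    than the halfspace of [w] through 0. *)
Lemma light_halfspace (B S : seq 'cV[R]_d) k x w g :
  (forall v, v != 0 -> (count (fun z => (0 <= dot v z)%R) B <= k)%N) ->
  w != 0 -> {in S, forall a, dot w a = 0} ->
  {in S, forall a, dot g a < dot g x} ->
  exists v, {in S, forall a, dot v (a - x) < 0} /\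
    (count (fun z => (0 <= dot v (z - x))%R) B <= k)%N.
Proof.
move=> Bk.
wlog wx : w / 0 <= dot w x.
  move=> H; have [|/ltW] := leP 0 (dot w x); first exact: H.
  rewrite -oppr_ge0 -dotNl => wx w0 wS; apply: (H (- w)) => //.
    by rewrite oppr_eq0.
  by move=> a /wS; rewrite dotNl => ->; rewrite oppr0.
move=> w0 wS gS.
have [e e0 he] := small_step (dot w) (fun z => dot g (z - x)) B.
exists (w + e *: g); split => [a aS|].
  rewrite dotDl dotZl dotBr wS // sub0r dotBr.
  have : e * (dot g a - dot g x) < 0 by rewrite pmulr_rlt0 // subr_lt0 gS.
  lra.
apply: leq_trans (Bk w w0); rewrite -(@eq_in_count _ (fun z =>
  (z \in B) && (0 <= dot (w + e *: g) (z - x))%R)) => [|z ->//].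
apply: sub_count => z /= /andP[zB]; rewrite !leNgt; apply: contra => wz.
rewrite dotDl dotZl dotBr; have := he z zB wz; lra.
Qed.

End Geometry.

(** * Upper bounds on the breakdown points *)

Section Upper.
Context (R : realType) (d : nat) (N : 'cV[R]_d -> R) (hN : is_norm N).
Implicit Types (B : seq 'cV[R]_d) (M b c : 'cV[R]_d).

Lemma norm_unbounded_on_line c b L : b != 0 -> exists t, L <= N (c + t *: b).
Proof.
move=> /(is_norm_gt0 hN) b0; pose t := (`|L| + N c) / N b.
exists t; have t0 : 0 <= t by rewrite divr_ge0 ?addr_ge0 ?is_norm_ge0 // ltW.
have := norm_triangle hN (c + t *: b) (- c); rewrite addrAC subrr add0r.
rewrite -scaleN1r !(norm_homogeneous hN) normrN1 mul1r ger0_norm //.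
rewrite divfK ?lt0r_neq0 //; have := ler_norm L; lra.
Qed.

(** An attack that adds [k] copies of a far point to a symmetric list [B]; it
    breaks down both models since additive corruption is a special case of
    total variation corruption. *)
Lemma breakdown_le_additive_attack B k : (0 < size B)%N ->
  perm_eq [seq - x | x <- B] B ->
  (forall L, exists M, L <= N M /\ forall x, x != M ->
    exists v, (count (fun z => (0 <= dot v (z - x))%R) (B ++ nseq k M) <= k)%N) ->
  (family_breakdown_add N (@halfspace_symmetric R d) <=
     (k%:R / (size B + k)%:R)%:E)%E /\
  (family_breakdown_TV N (@halfspace_symmetric R d) <=
     (k%:R / (size B + k)%:R)%:E)%E.
Proof.
move=> B0 BN far; have [q qB] := empirical_exists B0.
have qc := empirical_sym_center qB BN.
set eps : R := k%:R / _.
have e0 : 0 <= eps by rewrite divr_ge0.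
have e1 : eps < 1.
  by rewrite ltr_pdivrMr ?mul1r ?ltr_nat ?ltr0n ?addn_gt0 ?B0 // -[ltnLHS]add0n ltn_add2r.
have attack (C : set (distr R d)) : corrupt_add q eps `<=` C -> max_bias N C q = +oo%E.
  move=> addC; apply: max_bias_infty => // L; have [M [LM Mfar]] := far L.
  have [|p pB] := @empirical_exists R d (B ++ nseq k M).
    by rewrite size_cat addn_gt0 B0.
  exists p, M; split => //; first exact/addC/empirical_corrupt_add.
  apply: (empirical_median pB _ Mfar).
  by rewrite count_cat count_nseq /= eqxx mul1n leq_addl.
split; apply: ge_ereal_inf.
  exists (breakdown_add N q); first by exists q => //; exists 0.
  apply: ge_ereal_inf; exists eps%:E => //; exists eps => //.
  by split; [apply/andP|exact: attack].
exists (breakdown_TV N q); first by exists q => //; exists 0.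
apply: ge_ereal_inf; exists eps%:E => //; exists eps => //=.
by apply: attack => p; exact: corrupt_add_TV.
Qed.

(** An attack on the symmetric list made of [B] and [k] copies of [A] and of
    [- A]: the copies of [- A] are moved to a far point [M]. *)
Lemma breakdown_le_replacement_attack B A k : (0 < size B)%N ->
  perm_eq [seq - x | x <- B] B ->
  (forall L, exists M, L <= N M /\ forall x, x != M ->
    exists v, (count (fun z => (0 <= dot v (z - x))%R)
      (B ++ nseq k A ++ nseq k M) <= k)%N) ->
  (family_breakdown_TV N (@halfspace_symmetric R d) <=
     (k%:R / (size B + (k + k))%:R)%:E)%E.
Proof.
move=> B0 BN far; set eps : R := k%:R / _.
have [|q qB] := @empirical_exists R d (B ++ nseq k A ++ nseq k (- A)).
  by rewrite size_cat addn_gt0 B0.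
have qc : sym_center q 0.
  apply: (empirical_sym_center qB); rewrite !map_cat !map_nseq opprK.
  by rewrite perm_cat // perm_catC.
apply: ge_ereal_inf; exists (breakdown_TV N q); first by exists q => //; exists 0.
apply: ge_ereal_inf; exists eps%:E => //; exists eps => //=.
apply: max_bias_infty => // L; have [M [LM Mfar]] := far L.
have [|p pB] := @empirical_exists R d (B ++ nseq k A ++ nseq k M).
  by rewrite size_cat addn_gt0 B0.
exists p, M; split => //; last first.
  apply: (empirical_median pB _ Mfar).
  by rewrite !count_cat !count_nseq /= eqxx mul1n addnA leq_addl.
apply: ge_ereal_sup => _ [E _ <-]; rewrite qB pB -EFinB lee_fin /freq.
rewrite !size_cat !size_nseq -mulrBl ler_wpM2r ?invr_ge0 //.
rewrite !count_cat !count_nseq !natrD lerBlDr.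
have : ((- A \in E) * k)%:R <= k%:R + ((M \in E) * k)%:R :> R.
  by rewrite -natrD ler_nat; case: (- A \in E) => //; rewrite mul1n leq_addr.
lra.
Qed.

End Upper.

Lemma count_nseq_le (T : Type) (a : pred T) k x : (count a (nseq k x) <= k)%N.
Proof. by rewrite -[leqRHS](size_nseq k x) count_size. Qed.

Section Attacks.
Context (R : realType).

(** One atom at 0 against one atom at a far point. *)
Lemma breakdown_dim1_le (N : 'cV[R]_1 -> R) (hN : is_norm N) :
  (family_breakdown_add N (@halfspace_symmetric R 1) <= (1 / 2)%:E)%E /\
  (family_breakdown_TV N (@halfspace_symmetric R 1) <= (1 / 2)%:E)%E.
Proof.
apply: (@breakdown_le_additive_attack R 1 N hN [:: 0] 1) => //=.
  by rewrite oppr0.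
move=> L; have [|t tL] := @norm_unbounded_on_line R 1 N hN 0 (delta_mx ord0 ord0) L.
  by apply/eqP => /colP /(_ ord0); rewrite !mxE => /eqP; rewrite oner_eq0.
rewrite add0r in tL.
exists (t *: delta_mx ord0 ord0); set M := t *: _ in tL *; split => // x xM.
exists (x - M).
have -> : (0 <= dot (x - M) (M - x)) = false.
  by rewrite -[M - x]opprB dotNr oppr_ge0 leNgt dot_sq_gt0 ?subr_eq0.
by rewrite !addn0 leq_b1.
Qed.

Lemma large_multiple (D : nat) (e : R) : 0 < e ->
  exists2 n : nat, (0 < n)%N & D%:R <= e * n%:R.
Proof.
move=> e0; exists (Num.bound (D%:R / e)).+1 => //.
rewrite mulrC -ler_pdivrMr // ltW // (lt_trans (archi_boundP _)) ?ltr_nat //.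
by rewrite divr_ge0 // ltW.
Qed.

Context (d : nat) (N : 'cV[R]_d -> R) (hN : is_norm N).

(** Take [M] on the axis [i0].  The basis vector of [i1] is orthogonal to [M],
    and [x - M] separates [x] from [M], so [light_halfspace] applies to every
    [x] other than [M]. *)
Lemma moment_additive_attack (i0 i1 : 'I_d) n : (0 < n)%N -> i1 != i0 ->
  (family_breakdown_add N (@halfspace_symmetric R d) <=
     ((n + d.-1)%:R / (n + n + (n + d.-1))%:R)%:E)%E /\
  (family_breakdown_TV N (@halfspace_symmetric R d) <=
     ((n + d.-1)%:R / (n + n + (n + d.-1))%:R)%:E)%E.
Proof.
move=> n0 i10; rewrite -(size_moments R d n); set k := (n + d.-1)%N.
apply: breakdown_le_additive_attack => //.
- by rewrite size_moments addn_gt0 n0.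
- exact: moments_sym.
- move=> L; have [|t tL] := @norm_unbounded_on_line R d N hN 0 (delta_mx i0 ord0) L.
    by apply/eqP => /colP /(_ i0); rewrite !mxE !eqxx => /eqP; rewrite oner_eq0.
  rewrite add0r in tL.
  exists (t *: delta_mx i0 ord0); set M := t *: _ in tL *; split => // x xM.
  have [|||v [vM vB]] := @light_halfspace R d (moments R d n) [:: M] k x
    (delta_mx i1 ord0) (x - M) (fun v => @moments_halfspace R d v n).
  - by apply/eqP => /colP /(_ i1); rewrite !mxE !eqxx => /eqP; rewrite oner_eq0.
  - by move=> a; rewrite inE => /eqP ->; rewrite dot_delta !mxE (negPf i10) mulr0.
  - by move=> a; rewrite inE => /eqP ->; rewrite -subr_gt0 -dotBr dot_sq_gt0 ?subr_eq0.
  exists v; rewrite count_cat count_nseq /= leNgt vM ?inE ?eqxx //=.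
  by rewrite mul0n addn0.
Qed.

(** The coordinate [i0] equals 1 or -1 on the cloud, 3 on [A] and 2 on [M].  It
    therefore separates every point of the segment from [A] to [M] other than
    [M] both from [M] and from the cloud, leaving only the copies of [A].  For
    the other points [light_halfspace] applies with [S] made of [A] and [M],
    and with the basis vector of [i2], which is orthogonal to both since [M] moves
    away in the direction [i1]. *)
Lemma moment_replacement_attack (i0 i1 i2 : 'I_d) n : (0 < n)%N ->
  i0 = 0%N :> nat -> i1 != i0 -> i2 != i0 -> i2 != i1 ->
  (family_breakdown_TV N (@halfspace_symmetric R d) <=
    ((n + d.-1)%:R / (n + n + (n + d.-1 + (n + d.-1)))%:R)%:E)%E.
Proof.
move=> n0 i00 i10 i20 i21; rewrite -(size_moments R d n); set k := (n + d.-1)%N.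
pose e i : 'cV[R]_d := delta_mx i ord0.
have e_neq0 i : e i != 0.
  by apply/eqP => /colP /(_ i); rewrite !mxE !eqxx => /eqP; rewrite oner_eq0.
have eE i j : e i j ord0 = (j == i)%:R by rewrite mxE eqxx andbT.
apply: (@breakdown_le_replacement_attack _ _ _ hN _ (3%:R *: e i0)).
- by rewrite size_moments addn_gt0 n0.
- exact: moments_sym.
set A := 3%:R *: e i0.
move=> L; have [t tL] := norm_unbounded_on_line hN (2%:R *: e i0) L (e_neq0 i1).
set M := _ + _ in tL; exists M; split => // x xM.
have A0 : A i0 ord0 = 3%:R by rewrite mxE eE eqxx mulr1.
have M0 : M i0 ord0 = 2%:R.
  by rewrite !mxE !eqxx eq_sym (negPf i10) mulr0 addr0 mulr1.
have [[s [s0 s1 xE]]|out] := pselect (exists s, [/\ 0 <= s, s < 1 &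
    x = (1 - s) *: A + s *: M]).
  exists (e i0); rewrite count_cat.
  have xi : x i0 ord0 = (1 - s) * 3%:R + s * 2%:R.
    by rewrite xE mxE [X in X + _]mxE [X in _ + X]mxE A0 M0.
  rewrite (_ : count _ (moments R d n) = 0%N); last first.
    apply/eqP; rewrite -leqn0 leqNgt -has_count; apply/hasPn => z.
    have mi j : moment R d j i0 ord0 = 1 by rewrite mxE i00 expr0.
    rewrite -ltNge dot_delta mxE [X in _ + X]mxE xi.
    rewrite mem_cat => /orP[] /mapP [i _ ->]; rewrite ?[(- _ : 'cV[R]_d) i0 _]mxE mi; lra.
  rewrite add0n count_cat addnC count_nseq /= dot_delta.
  rewrite [(M - x) i0 _]mxE [(- x) i0 _]mxE xi M0 leNgt.
  rewrite (_ : _ < 0) ?mul0n ?add0n ?count_nseq_le //; lra.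
have [|g [gA gM]] := @separate_pair R d (A - x) (M - x).
  move=> s /andP[s0 s1]; apply/eqP => e0.
  have xE : x = (1 - s) *: A + s *: M.
    apply/eqP; rewrite -subr_eq0 -oppr_eq0 opprB -e0; apply/eqP/colP => i.
    by rewrite !mxE; ring.
  have [s1'|s1'] := ltP s 1; first by apply: out; exists s.
  have s11 : s = 1 by apply/eqP; rewrite eq_le s1 s1'.
  by move: xM; rewrite xE s11 subrr scale0r add0r scale1r eqxx.
have [|||v [vS vB]] := @light_halfspace R d (moments R d n) [:: A; M] k x
    (e i2) g (fun v => @moments_halfspace R d v n).
- exact: e_neq0.
- move=> a; rewrite !inE => /orP[] /eqP ->; rewrite dot_delta !mxE.
    by rewrite (negPf i20) mulr0.
  by rewrite (negPf i20) (negPf i21) !mulr0 addr0.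
- by move=> a; rewrite !inE => /orP[] /eqP ->; rewrite -subr_lt0 -dotBr.
exists v; rewrite count_cat [X in (_ + X)%N]count_cat !count_nseq /= !leNgt.
rewrite !vS ?inE ?eqxx ?orbT //=.
by rewrite !mul0n !addn0.
Qed.

Lemma breakdown_add_le_third : (1 < d)%N ->
  (family_breakdown_add N (@halfspace_symmetric R d) <= (1 / 3)%:E)%E /\
  (family_breakdown_TV N (@halfspace_symmetric R d) <= (1 / 3)%:E)%E.
Proof.
move=> d1; have d0 := ltnW d1.
suff H e : 0 < e -> exists2 r : R, r <= 1 / 3 + e &
    (family_breakdown_add N (@halfspace_symmetric R d) <= r%:E)%E /\
    (family_breakdown_TV N (@halfspace_symmetric R d) <= r%:E)%E.
  split; apply/lee_addgt0Pr => e /H [r re [ra rT]];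
    rewrite -EFinD; [apply: (le_trans ra)|apply: (le_trans rT)]; by rewrite lee_fin.
move=> e0; have [n n0 nD] := large_multiple d.-1 e0.
have [a b] := @moment_additive_attack (Ordinal d0) (Ordinal d1) n n0 isT.
exists ((n + d.-1)%:R / (n + n + (n + d.-1))%:R) => //.
have n1 : 1 <= n%:R :> R by rewrite ler1n.
have D0 : 0 <= d.-1%:R :> R by [].
rewrite !natrD ler_pdivrMr; nra.
Qed.

Lemma breakdown_TV_le_quarter : (2 < d)%N ->
  (family_breakdown_TV N (@halfspace_symmetric R d) <= (1 / 4)%:E)%E.
Proof.
move=> d2; have d1 := ltnW d2; have d0 := ltnW d1.
apply/lee_addgt0Pr => e e0; have [n n0 nD] := large_multiple d.-1 e0.
have := @moment_replacement_attack (Ordinal d0) (Ordinal d1) (Ordinal d2) n n0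
  erefl isT isT isT.
move=> /le_trans; apply; rewrite -EFinD lee_fin.
have n1 : 1 <= n%:R :> R by rewrite ler1n.
have D0 : 0 <= d.-1%:R :> R by [].
rewrite !natrD ler_pdivrMr; nra.
Qed.

End Attacks.

Theorem theorem1 (R : realType) (d : nat) (hd : (1 <= d)%N)
    (N : 'cV[R]_d -> R) (hN : is_norm N) :
  family_breakdown_add N (@halfspace_symmetric R d) =
    (if d == 1%N then 1 / 2 else 1 / 3)%:E /\
  family_breakdown_TV N (@halfspace_symmetric R d) =
    (if d == 1%N then 1 / 2 else if d == 2%N then 1 / 3 else 1 / 4)%:E.
Proof.
have lower c1 c2 : c1 <= 1 / 3 \/ c1 <= d.+1%:R^-1 -> c2 <= 1 / 4 \/ c2 <= d.+1%:R^-1 ->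
    (family_breakdown_add N (@halfspace_symmetric R d) <= c1%:E)%E ->
    (family_breakdown_TV N (@halfspace_symmetric R d) <= c2%:E)%E ->
    family_breakdown_add N (@halfspace_symmetric R d) = c1%:E /\
    family_breakdown_TV N (@halfspace_symmetric R d) = c2%:E.
  move=> h1 h2 l1 l2; split; apply/eqP; rewrite eq_le ?l1 ?l2 /=.
    exact: breakdown_add_ge.
  exact: breakdown_TV_ge.
case: d hd N hN lower => [//|[|[|d]]] _ N hN lower /=.
- by have [a b] := breakdown_dim1_le hN; apply: lower => //; right; lra.
- have [//|a b] := breakdown_add_le_third hN.
  by apply: lower => //; [left|right]; lra.
- have [//|a _] := breakdown_add_le_third hN.
  by apply: lower => //; [left|left|exact: breakdown_TV_le_quarter].
Qed.
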